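(* Let $\mathcal{C}_1$ and $\mathcal{C}_2$ be two $C^2$-smooth planar curves of the same Euclidean arc-length $L$. Let $\kappa_1(s)$ and $\kappa_2(s)$, $s\in[0,L]$, be their respective Euclidean curvature functions. If $\|\kappa_1-\kappa_2\|_{[0,L]}\le\delta$, then there exists $g\in SE(2)$ such that $$d(\mathcal{C}_1,\,g\,\mathcal{C}_2)\le\frac{\sqrt2}{2}\,\delta L^2,$$ where $d$ is the Hausdorff distance.
   Context: A planar curve $\mathcal{C}$ is the image of a continuous, locally injective map $\gamma$ from an interval to $\mathbb{R}^2$ (its parametrization). A $C^2$-smooth planar curve of Euclidean arc-length $L$ is given with its Euclidean arc-length parametrization $\gamma:[0,L]\to\mathbb{R}^2$, which is twice continuously differentiable with $|\gamma'(s)|=1$ for all $s$. Its Euclidean curvature function is $\kappa(s)=\det(\gamma'(s),\gamma''(s))=x'(s)y''(s)-y'(s)x''(s)$, where $\gamma=(x,y)$. $SE(2)$ is the special Euclidean group of the plane: all compositions of a rotation and a translation, $p\mapsto pR^{-1}+v$, with $p\in\mathbb{R}^2$ a row vector, $R\in SO(2)$ and $v\in\mathbb{R}^2$. For $g\in SE(2)$, $g\,\mathcal{C}=\{gp : p\in\mathcal{C}\}$. For a continuous function $f$ on $[0,L]$, $\|f\|_{[0,L]}=\max_{t\in[0,L]}|f(t)|$. The Hausdorff distance between subsets $P,Q\subset\mathbb{R}^2$ is $d(P,Q)=\max\{\sup_{p\in P}\inf_{q\in Q}|p-q|,\ \sup_{q\in Q}\inf_{p\in P}|p-q|\}$, with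 $|\cdot|$ the Euclidean norm. *)

(* Defs.v *)
From HB Require Import structures.
From mathcomp Require Import all_boot all_order all_algebra.
From mathcomp Require Import all_classical all_reals all_analysis.

Set Implicit Arguments.
Unset Strict Implicit.
Unset Printing Implicit Defensive.

Import Order.TTheory GRing.Theory Num.Theory.
Import numFieldNormedType.Exports.

Local Open Scope classical_set_scope.
Local Open Scope ring_scope.

(* Points of the plane are row vectors 'rV[R]_2 over an arbitrary realType.
   The library's norm `|v| on matrices is the sup norm, so the Euclidean norm
   has to be introduced separately. *)
Definition enorm (R : realType) (v : 'rV[R]_2) : R :=
  Num.sqrt (\sum_(i < 2) v 0 i ^+ 2).

(* Valued in \bar R, so that neither unbounded nor empty sets give rise to
   default values. *)
Definition hausdorff_dist (R : realType) (P Q : set 'rV[R]_2) : \bar R :=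
  Order.max
    (ereal_sup [set ereal_inf [set (enorm (p - q))%:E | q in Q] | p in P])
    (ereal_sup [set ereal_inf [set (enorm (p - q))%:E | p in P] | q in Q]).

(* For f continuous on a nonempty compact I, this is the maximum of |f|
   over I. *)
Definition sup_norm (R : realType) (I : set R) (f : R -> R) : \bar R :=
  ereal_sup [set `|f t|%:E | t in I].

(* Derivatives relative to a set I: the difference quotients at s only involve
   points t of I distinct from s.  For I = [0, L] this gives the usual two-sided
   derivative at interior points and the one-sided ones at 0 and L; values of f
   outside I are irrelevant. *)
Definition derivable_on (R : realType) (I : set R) (f : R -> 'rV[R]_2) (s : R)
    : Prop :=
  cvg ((fun t => (t - s)^-1 *: (f t - f s)) @ within I s^').

Definition derive_on (R : realType) (I : set R) (f : R -> 'rV[R]_2) (s : R)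
    : 'rV[R]_2 :=
  lim ((fun t => (t - s)^-1 *: (f t - f s)) @ within I s^').

Definition C2_on (R : realType) (I : set R) (f : R -> 'rV[R]_2) : Prop :=
  [/\ forall s, I s -> derivable_on I f s,
      forall s, I s -> derivable_on I (derive_on I f) s &
      {within I, continuous (derive_on I (derive_on I f))}].

Definition locally_injective_on (R : realType) (I : set R)
    (f : R -> 'rV[R]_2) : Prop :=
  forall s, I s -> exists2 U : set R, nbhs s U & set_inj (I `&` U) f.

Definition curve_parametrization (R : realType) (I : set R)
    (gamma : R -> 'rV[R]_2) : Prop :=
  {within I, continuous gamma} /\ locally_injective_on I gamma.

Definition C2_arclength_parametrization (R : realType) (L : R)
    (gamma : R -> 'rV[R]_2) : Prop :=
  [/\ curve_parametrization `[0, L] gamma,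
      C2_on `[0, L] gamma &
      forall s, s \in `[0, L] -> enorm (derive_on `[0, L] gamma s) = 1].

(* The rows of the 2 x 2 matrix are gamma' and gamma'', so its determinant is
   x' y'' - y' x''. *)
Definition curvature (R : realType) (L : R) (gamma : R -> 'rV[R]_2) (s : R)
    : R :=
  \det (col_mx (derive_on `[0, L] gamma s)
               (derive_on `[0, L] (derive_on `[0, L] gamma) s) : 'M[R]_2).

(* No unitarymx here: it requires a numClosedFieldType. *)
Definition SO2 (R : realType) : set 'M[R]_2 :=
  [set Q | Q *m Q^T = 1%:M /\ \det Q = 1].

Definition SE2 (R : realType) : set ('rV[R]_2 -> 'rV[R]_2) :=
  [set g | exists (Q : 'M[R]_2) (v : 'rV[R]_2),
     SO2 Q /\ forall p, g p = p *m invmx Q + v].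
Arguments SO2 : clear implicits.
Arguments SE2 : clear implicits.

(* Main.v *)
Require Import Defs.
From mathcomp Require Import all_boot all_order all_algebra.
From mathcomp Require Import ring lra.
From mathcomp Require Import all_classical all_reals all_analysis.
Import Order.TTheory GRing.Theory Num.Theory.
Import numFieldNormedType.Exports.
Local Open Scope classical_set_scope.
Local Open Scope ring_scope.

(** Move the second curve by the rigid motion that makes the initial points and
the initial unit tangents T1, T2 of the two curves agree.  After the motion the
curves even satisfy |gamma1 s - gamma2 s| <= delta * s ^+ 2 / 2 for every s,
which is below the announced bound because s <= L and 1 <= sqrt 2; comparing
points with the same parameter then bounds the Hausdorff distance.

The pointwise estimate integrates the curvature twice.  Let C and S be the
cosine and sine of the angle from T1 to T2, that is, the dot product and the
determinant of the two tangents.  The Frenet equations give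
C' = (k1 - k2) S and S' = - (k1 - k2) C, so the point (C, S) moves on the unit
circle with speed |k1 - k2| <= delta, starting at (1, 0).  Its distance to
(1, 0) at time s is therefore at most delta * s, and this chord has the same
length as T1 - T2 ([frenet_tangent_close]).  Now gamma1 - gamma2 starts at 0
with speed |T1 - T2| <= delta * s, so it has length at most
delta * s ^+ 2 / 2 ([frenet_point_close]).

Both steps use the same inequality, [planar_mean_value]: a plane motion whose
speed is at most B' has moved by at most the increase of B.  It follows from the
scalar mean value theorem by projecting on the direction of the displacement, so
neither angle functions nor integrals are involved. *)

(** * Primitives on a segment *)

Set Implicit Arguments.
Unset Strict Implicit.
Unset Printing Implicit Defensive.

(** The derivative is prescribed in the interior only, as in the mean value
theorem: one-sided derivatives at the endpoints reduce to continuity there, and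
two-sided derivatives are available everywhere else. *)
Definition primitive_on (R : realType) (a b : R) (F f : R -> R) : Prop :=
  {within `[a, b], continuous F} /\
  forall t, t \in `]a, b[ -> is_derive t 1 F (f t).

Section Primitives.
Context {R : realType}.
Implicit Types (a b s : R) (F f G g : R -> R).

Lemma eq_primitive a b F f g :
  {in `]a, b[, f =1 g} -> primitive_on a b F f -> primitive_on a b F g.
Proof.
by move=> fg [cF dF]; split=> // t tab; rewrite -fg //; exact: dF.
Qed.

Lemma primitive_cst a b (c : R) : primitive_on a b (fun=> c) (fun=> 0).
Proof. by split=> [t|t _]; [exact: cvg_cst|exact: is_derive_cst]. Qed.

Lemma primitive_id a b : primitive_on a b id (fun=> 1).
Proof.
split=> [|t _]; last exact: is_derive_id.
by apply: continuous_subspaceT => t; exact: cvg_id.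
Qed.

Lemma primitiveD a b F f G g :
  primitive_on a b F f -> primitive_on a b G g ->
  primitive_on a b (fun t => F t + G t) (fun t => f t + g t).
Proof.
move=> [cF dF] [cG dG]; split=> [t|t tab]; first exact: cvgD (cF t) (cG t).
by apply: is_deriveD; [exact: dF|exact: dG].
Qed.

Lemma primitiveM a b F f G g :
  primitive_on a b F f -> primitive_on a b G g ->
  primitive_on a b (fun t => F t * G t) (fun t => F t * g t + G t * f t).
Proof.
move=> [cF dF] [cG dG]; split=> [t|t tab]; first exact: cvgM (cF t) (cG t).
by apply: is_deriveM; [exact: dF|exact: dG].
Qed.

Lemma primitiveZ a b (c : R) F f :
  primitive_on a b F f -> primitive_on a b (fun t => c * F t) (fun t => c * f t).
Proof.
move=> hF; apply: eq_primitive (primitiveM (primitive_cst a b c) hF).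
by move=> t _ /=; rewrite mulr0 addr0.
Qed.

Lemma primitiveB a b F f G g :
  primitive_on a b F f -> primitive_on a b G g ->
  primitive_on a b (fun t => F t - G t) (fun t => f t - g t).
Proof.
move=> [cF dF] [cG dG]; split=> [t|t tab]; first exact: cvgB (cF t) (cG t).
by apply: is_deriveB; [exact: dF|exact: dG].
Qed.

(** This is the mean value theorem for G - F on [a, s]. *)
Lemma primitive_le a b s F f G g : s \in `[a, b] ->
  primitive_on a b F f -> primitive_on a b G g ->
  {in `]a, b[, forall t, f t <= g t} -> F s - F a <= G s - G a.
Proof.
rewrite in_itv /= => /andP[]; rewrite le_eqVlt => /predU1P[<- _ _ _ _|].
  by rewrite !subrr.
move=> a_s s_b hF hG fg; have [cH dH] := primitiveB hG hF.
have sub t : t \in `]a, s[ -> t \in `]a, b[.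
  rewrite !in_itv /= => /andP[-> ts]; exact: lt_le_trans ts s_b.
have dHs t : t \in `]a, s[ -> is_derive t 1 (fun t => G t - F t) (g t - f t).
  by move=> /sub; exact: dH.
have cHs : {within `[a, s], continuous (fun t => G t - F t)}.
  apply: continuous_subspaceW cH => t /=; rewrite !in_itv /= => /andP[-> ts].
  exact: le_trans ts s_b.
have [t tas E] := MVT a_s dHs cHs.
have : 0 <= (g t - f t) * (s - a).
  by rewrite mulr_ge0 ?subr_ge0 ?(ltW a_s)// fg// sub.
rewrite -E; lra.
Qed.

(** Passage from derivatives relative to a segment to [primitive_on].  At every
point, endpoints included, F t = (t - s) * quotient + F s tends to F s; at an
interior point the segment is a neighbourhood, so that the relative difference
quotient is the usual one. *)
Lemma primitive_of_quotient a b F f :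
  (forall s, `[a, b]%classic s ->
    (t - s)^-1 * (F t - F s) @[t --> within `[a, b] s^'] --> f s) ->
  primitive_on a b F f.
Proof.
move=> dF; split=> [|s sab].
  apply/subspace_continuousP => s sab.
  have {dF}dF := dF s sab.
  have lim0 : (t - s) * ((t - s)^-1 * (F t - F s)) + F s
      @[t --> within `[a, b] s^'] --> F s.
    have ts : t - s @[t --> within `[a, b] s^'] --> 0.
      rewrite -[X in _ --> X](subrr s); apply: cvgB; last exact: cvg_cst.
      move=> A /nbhs_dnbhs; exact: cvg_within.
    rewrite -[X in _ --> X]add0r -(mul0r (f s)).
    by apply: cvgD; [exact: cvgM ts dF|exact: cvg_cst].
  move=> A nA; have As := nbhs_singleton nA.
  have nF : \forall t \near s, t != s -> `[a, b]%classic t ->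
      A ((t - s) * ((t - s)^-1 * (F t - F s)) + F s) by exact: lim0 nA.
  apply: filterS nF => t At tab; have [->|ts] := eqVneq t s; first exact: As.
  by have := At ts tab; rewrite mulrA divff ?subr_eq0// mul1r subrK.
have {dF}dF := dF s (subset_itv_oo_cc sab).
have Dq : h^-1 *: ((F \o shift s) (h *: 1) - F s) @[h --> 0^'] --> f s.
  move=> A nA.
  have nF : \forall t \near s, t != s -> `[a, b]%classic t ->
      A ((t - s)^-1 * (F t - F s)) by exact: dF nA.
  have nI : \forall t \near s, `[a, b]%classic t.
    by apply: filterS (near_in_itvoo sab) => t; exact: subset_itv_oo_cc.
  have nFI : \forall t \near s, t != s -> A ((t - s)^-1 * (F t - F s)).
    by apply: filterS2 nF nI => t hA hI ts; exact: hA.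
  rewrite (near_shift 0 s) subr0 in nFI.
  apply: filterS nFI => h /= hA h0.
  rewrite /GRing.scale /= mulr1; move: hA; rewrite addrK; apply=> //.
  by rewrite -subr_eq0 addrK.
by split; [exact: cvgP Dq|exact: cvg_lim Dq].
Qed.

End Primitives.

(** * Mean value inequality for plane motions *)

Section PlanarMeanValue.
Context {R : realType}.
Implicit Types (a b s : R) (U u V v B : R -> R).

(** The displacement w = (U s - U a, V s - V a) is fixed; the projection of the
motion on w has derivative at most |w| * beta by Cauchy-Schwarz, so
|w| ^+ 2 <= |w| * (B s - B a), and |w| cancels unless it is 0. *)
Lemma planar_mean_value a b s U u V v B beta : s \in `[a, b] ->
  primitive_on a b U u -> primitive_on a b V v -> primitive_on a b B beta ->
  {in `]a, b[, forall t, 0 <= beta t /\ u t ^+ 2 + v t ^+ 2 <= beta t ^+ 2} ->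
  (U s - U a) ^+ 2 + (V s - V a) ^+ 2 <= (B s - B a) ^+ 2.
Proof.
move=> sab hU hV hB bnd.
set x := U s - U a; set y := V s - V a.
set w := Num.sqrt (x ^+ 2 + y ^+ 2).
have w2 : w ^+ 2 = x ^+ 2 + y ^+ 2 by rewrite sqr_sqrtr// addr_ge0// sqr_ge0.
have w0 : 0 <= w by exact: sqrtr_ge0.
have B0 : 0 <= B s - B a.
  have := primitive_le sab (primitive_cst a b 0) hB; rewrite subrr; apply.
  by move=> t /bnd[].
have : x * U s + y * V s - (x * U a + y * V a) <= w * B s - w * B a.
  apply: (primitive_le sab (primitiveD (primitiveZ x hU) (primitiveZ y hV))
    (primitiveZ w hB)) => t /bnd[beta0 uv].
  apply: le_trans (ler_norm _) _; rewrite -(ler_pXn2r (n := 2)) ?nnegrE//.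
  - rewrite real_normK ?num_real// exprMn w2.
    have : 0 <= (x ^+ 2 + y ^+ 2) * (beta t ^+ 2 - (u t ^+ 2 + v t ^+ 2)).
      by rewrite mulr_ge0 ?subr_ge0// -w2 sqr_ge0.
    (* Lagrange's identity makes the defect in Cauchy-Schwarz a square. *)
    have := sqr_ge0 (x * v t - y * u t); lra.
  - exact: mulr_ge0.
have -> : x * U s + y * V s - (x * U a + y * V a) = w ^+ 2.
  by rewrite w2 /x /y; ring.
rewrite -mulrBr -w2 => h; rewrite ler_pXn2r ?nnegrE//.
have [w_gt0|] := ltrP 0 w; first by move: h; rewrite expr2 ler_pM2l.
by move/le_trans; apply.
Qed.

End PlanarMeanValue.

(** * Comparison of two Frenet frames *)

Section Frenet.
Context {R : realType}.
Implicit Types (L delta : R) (x y p q k : R -> R).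

(** Coordinate form of the Frenet equations of a unit-speed curve (x, y) with
unit tangent (p, q), normal (- q, p) and curvature k. *)
Record frenet L x y p q k : Prop := Frenet {
  frenet_x : primitive_on 0 L x p;
  frenet_y : primitive_on 0 L y q;
  frenet_p : primitive_on 0 L p (fun s => - (k s * q s));
  frenet_q : primitive_on 0 L q (fun s => k s * p s);
  frenet_unit : {in `[0, L], forall s, p s ^+ 2 + q s ^+ 2 = 1}
}.

(** A rotation commutes with the quarter turn that sends the tangent to the
normal, hence preserves the Frenet equations together with k. *)
Lemma frenet_rigid L x y p q k m n c d : m ^+ 2 + n ^+ 2 = 1 ->
  frenet L x y p q k ->
  frenet L (fun s => m * x s - n * y s + c) (fun s => n * x s + m * y s + d)
    (fun s => m * p s - n * q s) (fun s => n * p s + m * q s) k.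
Proof.
move=> mn [hx hy hp hq pq]; split.
- apply: eq_primitive (primitiveD (primitiveB (primitiveZ m hx)
    (primitiveZ n hy)) (primitive_cst 0 L c)) => t _.
  by rewrite addr0.
- apply: eq_primitive (primitiveD (primitiveD (primitiveZ n hx)
    (primitiveZ m hy)) (primitive_cst 0 L d)) => t _.
  by rewrite addr0.
- apply: eq_primitive (primitiveB (primitiveZ m hp) (primitiveZ n hq)) => t _.
  by ring.
- apply: eq_primitive (primitiveD (primitiveZ n hp) (primitiveZ m hq)) => t _.
  by ring.
- move=> s /pq pqs; transitivity ((m ^+ 2 + n ^+ 2) * (p s ^+ 2 + q s ^+ 2)).
    by ring.
  by rewrite mn pqs mulr1.
Qed.

(** The chord from (1, 0) to (C, S), for C and S the cosine and sine of the angle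
between the tangents, has the same length as the difference of the tangents and
is traversed at speed |k1 - k2|. *)
Lemma frenet_tangent_close L delta x1 y1 p1 q1 k1 x2 y2 p2 q2 k2 :
  frenet L x1 y1 p1 q1 k1 -> frenet L x2 y2 p2 q2 k2 ->
  {in `[0, L], forall s, `|k1 s - k2 s| <= delta} ->
  p1 0 = p2 0 -> q1 0 = q2 0 ->
  {in `[0, L], forall s,
    (p1 s - p2 s) ^+ 2 + (q1 s - q2 s) ^+ 2 <= (delta * s) ^+ 2}.
Proof.
move=> [_ _ hp1 hq1 u1] [_ _ hp2 hq2 u2] k12 p0 q0 s sL.
have L0 : (0 : R) \in `[0, L].
  by move: sL; rewrite !in_itv /= lexx => /andP[]; exact: le_trans.
pose C t := p1 t * p2 t + q1 t * q2 t.
pose S t := p1 t * q2 t - q1 t * p2 t.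
have CS t : t \in `[0, L] -> C t ^+ 2 + S t ^+ 2 = 1.
  move=> tL; rewrite /C /S -[1]mulr1 -{1}(u1 t tL) -(u2 t tL); ring.
have hC : primitive_on 0 L C (fun t => (k1 t - k2 t) * S t).
  apply: eq_primitive (primitiveD (primitiveM hp1 hp2) (primitiveM hq1 hq2)).
  by move=> t _; rewrite /S; ring.
have hS : primitive_on 0 L S (fun t => - ((k1 t - k2 t) * C t)).
  apply: eq_primitive (primitiveB (primitiveM hp1 hq2) (primitiveM hq1 hp2)).
  by move=> t _; rewrite /C; ring.
have := planar_mean_value sL hC hS (primitiveZ delta (primitive_id 0 L)).
have -> : C 0 = 1 by rewrite /C p0 q0 -!expr2 u2.
have -> : S 0 = 0 by rewrite /S p0 q0; ring.
rewrite mulr0 !subr0 => H.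
suff -> : (p1 s - p2 s) ^+ 2 + (q1 s - q2 s) ^+ 2 = (C s - 1) ^+ 2 + S s ^+ 2.
  apply: H => t /subset_itv_oo_cc tL; rewrite mulr1.
  have kt := k12 t tL; split; first exact: le_trans (normr_ge0 _) kt.
  rewrite sqrrN !exprMn -mulrDr (addrC (S t ^+ 2)) CS// mulr1 -real_normK ?num_real//.
  by rewrite ler_pXn2r ?nnegrE//; exact: le_trans (normr_ge0 _) kt.
transitivity (p1 s ^+ 2 + q1 s ^+ 2 + (p2 s ^+ 2 + q2 s ^+ 2) - 2 * C s).
  by rewrite /C; ring.
rewrite u1// u2//.
transitivity (C s ^+ 2 + S s ^+ 2 + 1 - 2 * C s); last by ring.
by rewrite CS.
Qed.

(** Second integration: the bound delta * s on the difference of the tangents has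
primitive delta * s ^+ 2 / 2.  The factor 1 / 2 matters below, where the final
bound leaves room for sqrt 2 / 2 but not for 1. *)
Lemma frenet_point_close L delta x1 y1 p1 q1 k1 x2 y2 p2 q2 k2 :
  frenet L x1 y1 p1 q1 k1 -> frenet L x2 y2 p2 q2 k2 ->
  {in `[0, L], forall s, `|k1 s - k2 s| <= delta} ->
  x1 0 = x2 0 -> y1 0 = y2 0 -> p1 0 = p2 0 -> q1 0 = q2 0 ->
  {in `[0, L], forall s,
    (x1 s - x2 s) ^+ 2 + (y1 s - y2 s) ^+ 2 <= (delta * s ^+ 2 / 2) ^+ 2}.
Proof.
move=> F1 F2 k12 x0 y0 p0 q0 s sL.
have hB : primitive_on 0 L (fun t => delta / 2 * (t * t)) (fun t => delta * t).
  apply: eq_primitive (primitiveZ (delta / 2)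
    (primitiveM (primitive_id 0 L) (primitive_id 0 L))) => t _.
  by field.
have := planar_mean_value sL (primitiveB (frenet_x F1) (frenet_x F2))
  (primitiveB (frenet_y F1) (frenet_y F2)) hB.
rewrite x0 y0 !subrr !mulr0 !subr0.
have -> : delta * s ^+ 2 / 2 = delta / 2 * (s * s) by field.
apply=> t tL; have tL' := subset_itv_oo_cc tL.
split; last exact: frenet_tangent_close F1 F2 k12 p0 q0 t tL'.
apply: mulr_ge0; first exact: le_trans (normr_ge0 _) (k12 t tL').
by move: tL; rewrite in_itv /= => /andP[/ltW].
Qed.

End Frenet.

(** * Curves parametrized by arc length *)

Section Curves.
Context {R : realType}.
Implicit Types (L : R) (gamma : R -> 'rV[R]_2).

Lemma enormE (v : 'rV[R]_2) : enorm v = Num.sqrt (v 0 0 ^+ 2 + v 0 1 ^+ 2).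
Proof.
by rewrite /enorm !big_ord_recl big_ord0 addr0; do 4! f_equal; exact: val_inj.
Qed.

Lemma primitive_coord a b (f : R -> 'rV[R]_2) (i : 'I_2) :
  (forall s, `[a, b]%classic s -> derivable_on `[a, b] f s) ->
  primitive_on a b (fun s => f s 0 i) (fun s => derive_on `[a, b] f s 0 i).
Proof.
move=> df; apply: primitive_of_quotient => s /df fs.
have := cvg_comp _ _ fs (@coord_continuous R 1 2 0 i _).
apply: cvg_trans; apply: near_eq_cvg; near=> t.
by rewrite /= !mxE.
Unshelve. all: by end_near. Qed.

Lemma det_mx22 (M : 'M[R]_2) : \det M = M 0 0 * M 1 1 - M 0 1 * M 1 0.
Proof.
rewrite (expand_det_row _ 0) !big_ord_recl big_ord0 addr0.
rewrite /cofactor !det_mx11 !mxE /= expr0 expr1 mul1r mulN1r mulrN.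
by do 4! f_equal; [exact: val_inj..|f_equal|f_equal]; exact: val_inj.
Qed.

Lemma curvatureE L gamma s :
  let T := derive_on `[0, L] gamma in let A := derive_on `[0, L] T in
  curvature L gamma s = T s 0 0 * A s 0 1 - T s 0 1 * A s 0 0.
Proof.
move=> T A; rewrite /curvature -/T -/A det_mx22.
have r0 j : (col_mx (T s) (A s) : 'M[R]_2) 0 j = T s 0 j.
  by rewrite -(col_mxEu (T s) (A s)); f_equal; exact: val_inj.
have r1 j : (col_mx (T s) (A s) : 'M[R]_2) 1 j = A s 0 j.
  by rewrite -(col_mxEd (T s) (A s)); f_equal; exact: val_inj.
by rewrite !r0 !r1.
Qed.

(** The tangent T has constant norm, so T' is orthogonal to T, hence a multiple of
the normal; the determinant of T and T' is the factor. *)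
Lemma frenet_of_arclength L gamma :
  C2_arclength_parametrization L gamma ->
  let T := derive_on `[0, L] gamma in
  frenet L (fun s => gamma s 0 0) (fun s => gamma s 0 1)
    (fun s => T s 0 0) (fun s => T s 0 1) (curvature L gamma).
Proof.
move=> [_ [dg dT _] unit] T.
have pq : {in `[0, L], forall s, T s 0 0 ^+ 2 + T s 0 1 ^+ 2 = 1}.
  move=> s /unit; rewrite enormE => /(congr1 (fun r => r ^+ 2)).
  by rewrite sqr_sqrtr ?expr1n// addr_ge0// sqr_ge0.
have hp := primitive_coord 0 dT; have hq := primitive_coord 1 dT.
rewrite -/T in hp hq.
pose A := derive_on `[0, L] T; rewrite -/A in hp hq.
have orth : {in `]0, L[, forall s, T s 0 0 * A s 0 0 + T s 0 1 * A s 0 1 = 0}.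
  move=> s sL.
  have [_ /(_ s sL) dE] := primitiveD (primitiveM hp hp) (primitiveM hq hq).
  have dc : is_derive s 1 (fun t => T t 0 0 * T t 0 0 + T t 0 1 * T t 0 1) 0.
    apply: (@near_eq_is_derive R R^o R^o (cst 1)).
    apply: filterS (near_in_itvoo sL) => t /subset_itv_oo_cc tL.
    by rewrite -!expr2 pq.
  have := @derive_val _ _ _ _ _ _ _ dE; rewrite (@derive_val _ _ _ _ _ _ _ dc).
  lra.
split.
- exact: primitive_coord.
- exact: primitive_coord.
- apply: eq_primitive hp => s sL; rewrite curvatureE -/T -/A.
  have o := orth s sL; have u := pq s (subset_itv_oo_cc sL).
  transitivity (A s 0 0 * (T s 0 0 ^+ 2 + T s 0 1 ^+ 2)
      - T s 0 0 * (T s 0 0 * A s 0 0 + T s 0 1 * A s 0 1)).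
    by rewrite o u; ring.
  by ring.
- apply: eq_primitive hq => s sL; rewrite curvatureE -/T -/A.
  have o := orth s sL; have u := pq s (subset_itv_oo_cc sL).
  transitivity (A s 0 1 * (T s 0 0 ^+ 2 + T s 0 1 ^+ 2)
      - T s 0 1 * (T s 0 0 * A s 0 0 + T s 0 1 * A s 0 1)).
    by rewrite o u; ring.
  by ring.
- exact: pq.
Qed.

(** Each point of one curve is compared with the point of the other curve that
has the same parameter. *)
Lemma hausdorff_dist_le (I : set R) (f h : R -> 'rV[R]_2) (M : R) :
  (forall s, I s -> enorm (f s - h s) <= M) ->
  (hausdorff_dist (f @` I) (h @` I) <= M%:E)%E.
Proof.
move=> fh; rewrite /hausdorff_dist ge_max; apply/andP.
split; apply: ub_ereal_sup => _ [_ [s Is <-] <-].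
- have := fh s Is; rewrite -lee_fin; apply: le_trans.
  by apply: ereal_inf_lbound; exists (h s) => //; exists s.
- have := fh s Is; rewrite -lee_fin; apply: le_trans.
  by apply: ereal_inf_lbound; exists (f s) => //; exists s.
Qed.

End Curves.

(** * Rotations acting on row vectors *)

Section Rotation.
Context {R : realType}.

(** When m and n are the cosine and sine of an angle, right multiplication of row
vectors by this matrix is the counterclockwise rotation by that angle. *)
Definition rotation (m n : R) : 'M[R]_2 :=
  \matrix_(i, j) if i == j then m else if i == 0 then n else - n.

Lemma mul_rotation (m n : R) (v : 'rV[R]_2) :
  (v *m rotation m n) 0 0 = m * v 0 0 - n * v 0 1 /\
  (v *m rotation m n) 0 1 = n * v 0 0 + m * v 0 1.
Proof.
have E j : (v *m rotation m n) 0 j =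
    v 0 0 * rotation m n 0 j + v 0 1 * rotation m n 1 j.
  rewrite mxE !big_ord_recl big_ord0 addr0.
  by congr (_ + _ * _); [|congr (rotation m n _ j)]; f_equal; exact: val_inj.
by rewrite !E !mxE /=; split; ring.
Qed.

Lemma rotation_SO2 (m n : R) : m ^+ 2 + n ^+ 2 = 1 ->
  SO2 R (rotation m n)^T /\ invmx (rotation m n)^T = rotation m n.
Proof.
move=> mn.
have QQ : (rotation m n)^T *m rotation m n = 1%:M.
  apply/matrixP => i j; rewrite !mxE !big_ord_recl big_ord0 !mxE.
  case: i j => [[|[|//]] ?] [[|[|//]] ?] /=; rewrite -?val_eqE /=;
    by rewrite ?mulr1n ?mulr0n -?mn; ring.
have uQ : (rotation m n)^T \in unitmx by case/mulmx1_unit: QQ.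
have dQ : \det (rotation m n)^T = 1.
  by rewrite det_mx22 !mxE /= -mn; ring.
split; first by split=> //; rewrite trmxK QQ.
by rewrite -[RHS](mulKmx uQ) QQ mulmx1.
Qed.

End Rotation.

(** * Closeness of curves with close curvatures *)

Unset Implicit Arguments.

Theorem theorem12 (R : realType) (L delta : R) (gamma1 gamma2 : R -> 'rV[R]_2)
    (L_gt0 : 0 < L)
    (gamma1_C2 : C2_arclength_parametrization L gamma1)
    (gamma2_C2 : C2_arclength_parametrization L gamma2)
    (kappa_close :
      (sup_norm `[0%R, L]
         (fun s => curvature L gamma1 s - curvature L gamma2 s)%R
       <= delta%:E)%E) :
  exists2 g : 'rV[R]_2 -> 'rV[R]_2, SE2 R g &
    (hausdorff_dist (gamma1 @` `[0%R, L]) (g @` (gamma2 @` `[0%R, L]))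
     <= (Num.sqrt 2 / 2 * delta * L ^+ 2)%:E)%E.
Proof.
have F1 := frenet_of_arclength gamma1_C2; have F2 := frenet_of_arclength gamma2_C2.
set T1 := derive_on _ gamma1 in F1; set T2 := derive_on _ gamma2 in F2.
have L0 : (0 : R) \in `[0, L] by rewrite in_itv /= lexx ltW.
have u1 := frenet_unit F1 L0; have u2 := frenet_unit F2 L0.
have k12 : {in `[0, L], forall s,
    `|curvature L gamma1 s - curvature L gamma2 s| <= delta}.
  move=> s sL; rewrite -lee_fin; apply: le_trans kappa_close.
  by apply: ereal_sup_ubound; exists s.
have delta_ge0 : 0 <= delta := le_trans (normr_ge0 _) (k12 0 L0).
(* m and n are the cosine and sine of the angle from T2 0 to T1 0; c and d make
   the rotated initial point of gamma2 coincide with that of gamma1. *)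
pose m := T1 0 0 0 * T2 0 0 0 + T1 0 0 1 * T2 0 0 1.
pose n := T1 0 0 1 * T2 0 0 0 - T1 0 0 0 * T2 0 0 1.
have mn : m ^+ 2 + n ^+ 2 = 1.
  by rewrite -[1]mulr1 -{1}u1 -u2 /m /n; ring.
pose c := gamma1 0 0 0 - (m * gamma2 0 0 0 - n * gamma2 0 0 1).
pose d := gamma1 0 0 1 - (n * gamma2 0 0 0 + m * gamma2 0 0 1).
have F2' := frenet_rigid c d mn F2.
have close := frenet_point_close F1 F2' k12.
pose v : 'rV[R]_2 := \row_j (if j == 0 then c else d).
have [rSO2 rV] := rotation_SO2 mn.
exists (fun p => p *m rotation m n + v).
  by exists (rotation m n)^T, v; split=> // p; rewrite rV.
rewrite image_comp; apply: hausdorff_dist_le => s sL.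
have [r0 r1] := mul_rotation m n (gamma2 s).
have vE : v 0 0 = c /\ v 0 1 = d by rewrite !mxE.
have {}close : (gamma1 s 0 0 - (m * gamma2 s 0 0 - n * gamma2 s 0 1 + c)) ^+ 2
    + (gamma1 s 0 1 - (n * gamma2 s 0 0 + m * gamma2 s 0 1 + d)) ^+ 2
    <= (delta * s ^+ 2 / 2) ^+ 2.
  apply: close sL; rewrite /c /d.
  - ring.
  - ring.
  - rewrite -[LHS]mulr1 -u2 /m /n; ring.
  - rewrite -[LHS]mulr1 -u2 /m /n; ring.
have entry j : (gamma1 s - (gamma2 s *m rotation m n + v)) 0 j =
    gamma1 s 0 j - ((gamma2 s *m rotation m n) 0 j + v 0 j).
  by rewrite mxE [X in _ + X]mxE [X in - X]mxE.
rewrite enormE /= !entry r0 r1 vE.1 vE.2; apply: le_trans (ler_wsqrtr close) _.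
have s2 : s ^+ 2 <= L ^+ 2.
  move: sL; rewrite /= in_itv /= => /andP[s0 sL].
  by rewrite ler_pXn2r ?nnegrE ?(ltW L_gt0).
rewrite sqrtr_sqr ger0_norm; last by rewrite divr_ge0// mulr_ge0// sqr_ge0.
have sqrt2 : 1 <= Num.sqrt 2 :> R by rewrite -[X in X <= _]sqrtr1 ler_wsqrtr// ler1n.
apply: (@le_trans _ _ (delta * L ^+ 2 / 2)).
  by rewrite ler_wpM2r ?invr_ge0// ler_wpM2l.
have -> : Num.sqrt 2 / 2 * delta * L ^+ 2 = Num.sqrt 2 * (delta * L ^+ 2 / 2).
  by field.
by rewrite ler_peMl// divr_ge0// mulr_ge0// sqr_ge0.
Qed.
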